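(* Let $n$ be a positive integer. There is a canonical bijection between the set of admissible permutations $\pi$ of $\{0,\ldots,2^{n(M+1)}-1\}$ and the set of representations of $S^*_n$ as a sum (equality holding pointwise, as functions on $(0,1)$) $$S^*_n=\sum_{i=1}^n R^*_{n,i},$$ where $(R^*_{n,i}\mid 1\le i\le n)$ is an i.i.d. family of $n$-trim random variables on $(0,1)$, each of which has mean $0$, variance $1$, and has the outcomes $o_1,\ldots,o_m$ of $O$ as values, with equal probability. The canonical bijection sends an admissible $\pi$ to the family defined by: for $x\in D_{n,\ell}$ with $0\le \ell<2^{n(M+1)}$ and $1\le i\le n$, $R^*_{n,i}(x):=R_i(y)$ for any $y\in E_{n,\pi(\ell)}$.
   Context: Work in the probability space $(0,1)$ with Lebesgue measure. For $x\in(0,1)$ write $x=\sum_{i\ge1}\varepsilon_i(x)2^{-i}$ with $\varepsilon_i(x)\in\{0,1\}$ and $\varepsilon_i(x)=0$ for infinitely many $i$. Fix an integer $M\ge 0$, put $m=2^{M+1}$, and fix a random variable $O:(0,1)\to\mathbb{R}$ such that $O(x)$ depends bijectively on $(\varepsilon_1(x),\ldots,\varepsilon_{M+1}(x))$. Its $m$ distinct outcomes are enumerated increasingly as $o_1<\cdots<o_m$; they are equally likely, $\sum_s o_s=0$, and $O$ has variance $1$, i.e. $\sum_s o_s^2=m$. Let $\varsigma_s\in\{0,1\}^{M+1}$ be such that $O(x)=o_s$ iff $(\varepsilon_1(x),\ldots,\varepsilon_{M+1}(x))=\varsigma_s$. Arrange the positive integers consecutively, in increasing order, in rows indexed by $\rho=1,2,\ldots$,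 where row $\rho$ has length $b$, the unique positive integer with $(b-1)(M+1)<\rho\le b(M+1)$. Let $J_i$ be the $i$-th column (the set of $i$-th entries of all rows of length $\ge i$), enumerated increasingly as $j_{i,1}<j_{i,2}<\cdots$; let $\overline J_i=\{j_{i,1},\ldots,j_{i,M+1}\}$ and $\overline J^n=\overline J_1\cup\cdots\cup\overline J_n$. Let $P_i(x)$ be the number with $\varepsilon_k(P_i(x))=\varepsilon_{j_{i,k}}(x)$ for all $k$, and $R_i(x)=O(P_i(x))$; that is, for every $x\in(0,1)$, $R_i(x)=o_s$ iff $(\varepsilon_{j_{i,1}}(x),\ldots,\varepsilon_{j_{i,M+1}}(x))=\varsigma_s$. Put $S_n=\sum_{i=1}^n R_i$. The quantile $S^*_n$ of $S_n$ is $S^*_n(x)=\inf\{t\in\mathbb{R}\mid C(t)>x\}$ for $x\in(0,1)$, where $C$ is the cumulative distribution function of $S_n$. A random variable $Y$ on $(0,1)$ is $n$-trim iff $Y(y)$ depends only on $(\varepsilon_1(y),\ldots,\varepsilon_{n(M+1)}(y))$. For $0\le\ell<2^{n(M+1)}$: $D_{n,0}=(0,2^{-n(M+1)})$ and $D_{n,\ell}=[\ell 2^{-n(M+1)},(\ell+1)2^{-n(M+1)})$ for $\ell>0$. Let $(\vec e_\ell\mid 0\le\ell<2^{n(M+1)})$ be the lexicographically increasing enumeration of $\{0,1\}^{\overline J^n}$ (coordinates $\overline J^n$ taken in increasing order), and $E_{n,\ell}=\{x\in(0,1)\mid \varepsilon_j(x)=(\vec e_\ell)_j\text{ for all }j\in\overline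 J^n\}$. Each $R_i$ ($1\le i\le n$), and hence $S_n$, is constant on each $E_{n,\ell}$. A permutation $\pi$ of $\{0,\ldots,2^{n(M+1)}-1\}$ is admissible iff for all $0\le\ell<2^{n(M+1)}$: $S^*_n(x)=S_n(y)$ for all $x\in D_{n,\ell}$ and all $y\in E_{n,\pi(\ell)}$. *)

(* Defs.v *)
From HB Require Import structures.
From mathcomp Require Import all_boot all_order all_algebra perm.
From mathcomp Require Import all_classical all_reals all_analysis measurable_realfun.
From mathcomp Require Import zify lra ring.

Set Implicit Arguments.
Unset Strict Implicit.
Unset Printing Implicit Defensive.

Import Order.TTheory GRing.Theory Num.Theory.
Import numFieldNormedType.Exports.

Local Open Scope classical_set_scope.
Local Open Scope ring_scope.

(* The sample space is the type of points of (0,1), with the trace of the Borel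
   sigma-algebra of R, so that equality of random variables is pointwise
   equality on (0,1) and nothing outside (0,1) matters. *)
Definition unitI (R : realType) : Type := {x : R | 0 < x < 1}.

Section unit_interval.
Context {R : realType}.

HB.instance Definition _ :=
  Choice.copy (unitI R) {x : R | 0 < x < 1}.

Lemma half_in_unitI : 0 < (2^-1 : R) < 1.
Proof. by apply/andP; split; lra. Qed.

HB.instance Definition _ :=
  isPointed.Build (unitI R) (exist (fun x : R => is_true (0 < x < 1)) 2^-1 half_in_unitI).

Definition pt (x : unitI R) : measurableTypeR R := sval x.

HB.instance Definition _ :=
  Measurable.copy (unitI R) (g_sigma_algebra_preimageType pt).

Definition unit_prob (A : set (unitI R)) : \bar R :=
  lebesgue_measure (pt @` A).

Let unit_prob0 : unit_prob set0 = 0%E.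
Proof. by rewrite /unit_prob image_set0 measure0. Qed.

Let unit_prob_ge0 A : (0 <= unit_prob A)%E.
Proof. exact: measure_ge0. Qed.

Lemma pt_inj : injective pt.
Proof. exact: val_inj. Qed.

Lemma range_pt : range pt = `]0, 1[%classic.
Proof.
apply/seteqP; split=> [_ [x _ <-]|r] /=; rewrite in_itv/=; first exact: (svalP x).
by move=> r01; exists (exist _ r r01).
Qed.

Lemma measurable_image_pt (A : set (unitI R)) :
  measurable A -> measurable (pt @` A).
Proof.
move=> [B mB <-]; rewrite setTI.
have -> : pt @` (pt @^-1` B) = B `&` `]0, 1[%classic.
  rewrite -range_pt; apply/seteqP; split=> [r [x Bx xr]|r [Br [x _ xr]]].
    by rewrite -xr; split=> //; exists x.
  by exists x => //; rewrite /preimage/= xr.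
exact: measurableI.
Qed.

Let unit_prob_sigma_additive : semi_sigma_additive unit_prob.
Proof.
move=> F mF tF mUF; rewrite /unit_prob image_bigcup.
apply: (@measure_semi_sigma_additive _ _ _ lebesgue_measure
  (fun k => pt @` F k)).
- by move=> k; exact: measurable_image_pt.
- apply/trivIsetP => i j _ _ ij.
  have /trivIsetP/(_ i j I I ij) Fij := tF.
  apply/seteqP; split=> // z [[x Fx xz] [y Fy yz]].
  have xy : x = y by apply: pt_inj; rewrite xz yz.
  by have : (F i `&` F j) x; [split => //; rewrite xy | rewrite Fij].
- by rewrite -image_bigcup; exact: measurable_image_pt.
Qed.

HB.instance Definition _ := isMeasure.Build _ _ _ unit_prob
  unit_prob0 unit_prob_ge0 unit_prob_sigma_additive.

Let unit_prob_setT : unit_prob setT = 1%:E.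
Proof.
by rewrite /unit_prob range_pt lebesgue_measure_itv/= lte_fin ltr01 sube0.
Qed.

HB.instance Definition _ :=
  Measure_isProbability.Build _ _ _ unit_prob unit_prob_setT.

End unit_interval.

Section digits.
Context {R : realType}.

(* [e k] is the digit of weight 2^-(k+1). *)
Definition binary_expansion (x : R) (e : nat -> bool) : Prop :=
  (\sum_(0 <= k < N) (e k)%:R * 2 ^- k.+1 @[N --> \oo] --> x) /\
  (forall N : nat, exists2 k, (N <= k)%N & e k = false).

(* The digit of weight 2^-i, for i >= 1. *)
Definition digit (x : unitI R) (i : nat) : bool :=
  xget (fun=> false) [set e | binary_expansion (pt x) e] i.-1.

Lemma binary_expansion_ex (x : R) : 0 <= x < 1 ->
  exists e, binary_expansion x e.
Proof.
move=> /andP[x0 x1].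
pose t N := Num.truncn (x * 2 ^+ N).
have p2 N : 0 < 2 ^+ N :> R by rewrite exprn_gt0.
have tP N : (t N)%:R <= x * 2 ^+ N < (t N).+1%:R.
  by apply: truncn_itv; rewrite mulr_ge0 // ltW.
pose e k := odd (t k.+1).
have tS N : t N.+1 = ((t N).*2 + e N)%N.
  have /andP[a b] := tP N; have /andP[c d] := tP N.+1.
  rewrite /e; move: (t N.+1) (t N) a b c d => u v a b c d.
  rewrite exprS mulrCA in c d.
  have uv : (u < v.+1.*2)%N.
    rewrite -(ltr_nat R) -mul2n natrM; apply: le_lt_trans c _.
    by rewrite ltr_pM2l.
  have vu : (v.*2 < u.+1)%N.
    rewrite -(ltr_nat R) -mul2n natrM; apply: le_lt_trans d.
    by rewrite ler_pM2l.
  have := odd_double_half u; lia.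
have sumE N : \sum_(0 <= k < N) (e k)%:R * 2 ^- k.+1 = (t N)%:R / 2 ^+ N :> R.
  elim: N => [|N IH].
    rewrite big_nil; suff -> : t 0%N = 0%N by rewrite mul0r.
    apply/eqP; rewrite -leqn0 -ltnS -(ltr_nat R).
    by have /andP[+ _] := tP 0%N; rewrite expr0 mulr1 => /le_lt_trans; apply.
  rewrite big_nat_recr //= IH tS natrD -mul2n natrM exprS invfM.
  by field; rewrite gt_eqF.
exists e; split.
- apply/cvgrPdist_le => /= eps eps0.
  near=> N.
  rewrite sumE ger0_norm; last first.
    by rewrite subr_ge0 ler_pdivrMr//; case/andP: (tP N).
  apply: (@le_trans _ _ (2 ^- N)).
    rewrite lerBlDr -[X in X + _]mul1r -mulrDl ler_pdivlMr // nat1r.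
    by case/andP: (tP N) => _ /ltW.
  rewrite -exprVn; near: N.
  have /cvgrPdist_le/(_ _ eps0) : (2^-1 : R) ^+ n @[n --> \oo] --> 0.
    by apply: cvg_expr; rewrite ger0_norm ?invf_lt1 ?ltr1n.
  by apply: filterS => n; rewrite sub0r normrN ger0_norm // exprn_ge0.
- move=> N; apply/not_exists2P => h.
  have eT k : e (N + k)%N = true.
    by have := h (N + k)%N; rewrite leq_addr; case: (e _) => // -[].
  have tj j : (t (N + j)%N).+1 = (2 ^ j * (t N).+1)%N.
    elim: j => [|j IH]; first by rewrite addn0 mul1n.
    by rewrite addnS tS eT addn1 expnS -mulnA -IH -doubleS mul2n.
  have /andP[_ b] := tP N.
  have d0 : 0 < (t N).+1%:R - x * 2 ^+ N by rewrite subr_gt0.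
  have /cvgrPdist_lt/(_ _ d0) : (2^-1 : R) ^+ n @[n --> \oo] --> 0.
    by apply: cvg_expr; rewrite ger0_norm ?invf_lt1 ?ltr1n.
  move=> [j _ /(_ j (leqnn j))] /=.
  rewrite sub0r normrN ger0_norm ?exprn_ge0 // exprVn.
  rewrite -(ltr_pM2r (p2 j)) mulVf ?gt_eqF// mulrBl -mulrA -exprD.
  rewrite ltNge => /negP; apply.
  have /andP[c _] := tP (N + j)%N.
  rewrite lerBlDr -natrX -natrM mulnC -tj -nat1r.
  by rewrite lerD2l.
Unshelve. all: by end_near. Qed.

Lemma digitP (x : unitI R) : binary_expansion (pt x) (fun k => digit x k.+1).
Proof.
have /andP[x0 x1] := svalP x.
have [e he] : exists e, binary_expansion (pt x) e.
  by apply: binary_expansion_ex; rewrite ltW.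
exact: (xgetI (fun=> false) he).
Qed.

End digits.

Section arrangement.
Local Open Scope nat_scope.
Variable M : nat.
Implicit Types (rho i j k : nat).

Definition row_length rho : nat := (rho.-1 %/ M.+1).+1.

Lemma row_lengthP rho b : (0 < rho)%N -> (0 < b)%N ->
  (b.-1 * M.+1 < rho <= b * M.+1)%N = (b == row_length rho).
Proof.
rewrite /row_length; case: rho => // r; case: b => // c _ _ /=.
have := divn_eq r M.+1; have := ltn_pmod r (ltn0Sn M).
move: (r %% M.+1)%N (r %/ M.+1)%N => u v uM ->.
apply/idP/eqP => [/andP[]|[->]]; last by apply/andP; split; nia.
by move=> *; suff -> : c = v by []; nia.
Qed.

(* The [i]-th entry of row [rho]: the rows before it are filled first. *)
Definition row_entry rho i : nat :=
  (\sum_(1 <= r < rho) row_length r + i)%N.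

Definition column i : set nat :=
  [set j | exists2 rho, (0 < rho)%N && (i <= row_length rho)%N
                        & j = row_entry rho i].

Definition increasing_enum (J : set nat) (f : nat -> nat) : Prop :=
  {homo f : a b / (a < b)%N} /\ range f = J.

(* j_{i,k} for i, k >= 1. *)
Definition col_index i k : nat :=
  xget (fun a : nat => a) [set f | increasing_enum (column i) f] k.-1.

Lemma row_entry_ltn rho rho' i : (0 < rho < rho')%N ->
  (row_entry rho i < row_entry rho' i)%N.
Proof.
move=> /andP[r0 rr]; rewrite /row_entry ltn_add2r.
rewrite [X in (_ < X)%N](@big_cat_nat _ _ _ rho) //= ?(ltnW rr)// -[X in (X < _)%N]addn0.
by rewrite ltn_add2l big_ltn // /row_length.
Qed.

Lemma increasing_enum_column i : (0 < i)%N ->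
  increasing_enum (column i) (fun k => row_entry (i.-1 * M.+1 + k.+1) i).
Proof.
move=> i0; split=> [a b ab|].
  by apply: row_entry_ltn; rewrite ltn_add2l !ltnS ab addnS.
apply/seteqP; split=> [_ [k _ <-]|_ [rho /andP[r0 ir] ->]] /=.
  exists (i.-1 * M.+1 + k.+1)%N => //; rewrite addnS /row_length /=.
  by rewrite divnMDl //; move: (k %/ M.+1) i0 => q; lia.
exists (rho.-1 - i.-1 * M.+1)%N => //; congr row_entry.
have : (i.-1 * M.+1 <= rho.-1)%N.
  by rewrite -leq_divRL // -ltnS prednK.
by move=> h; rewrite addnS subnKC // prednK.
Qed.

Lemma increasing_enum_unique (J : set nat) f g :
  increasing_enum J f -> increasing_enum J g -> f = g.
Proof.
move=> [fi fJ] [gi gJ].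
have mono (h : nat -> nat) : {homo h : a b / (a < b)%N} ->
  {mono h : a b / (a <= b)%N} by move=> hi; apply: leq_mono.
have key (h h' : nat -> nat) : {homo h : a b / (a < b)%N} ->
    {homo h' : a b / (a < b)%N} -> range h = range h' ->
    forall k, (forall l, (l < k)%N -> h l = h' l) -> (h' k <= h k)%N.
  move=> hi hi' hh k IH.
  have [l _ hl] : range h' (h k) by rewrite -hh; exists k.
  rewrite -hl mono // leqNgt; apply/negP => lk.
  by have := hi _ _ lk; rewrite -hl IH // ltnn.
apply/funext => k; elim/ltn_ind: k => k IH.
apply/eqP; rewrite eqn_leq; apply/andP; split.
  by apply: key => // [|l lk]; [rewrite fJ gJ | rewrite IH].
by apply: key => //; rewrite fJ gJ.
Qed.

Lemma col_indexE i k : (0 < i)%N -> (0 < k)%N ->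
  col_index i k = row_entry (i.-1 * M.+1 + k) i.
Proof.
move=> i0 k0; rewrite /col_index.
have he := increasing_enum_column i0.
have := xgetI (fun a : nat => a) he => /increasing_enum_unique/(_ he) ->.
by rewrite prednK.
Qed.

Definition Jbar1 i : seq nat := [seq col_index i k | k <- iota 1 M.+1].

(* The union of the [Jbar1 i], 1 <= i <= n, listed increasingly. *)
Definition Jbar n : seq nat :=
  sort leq (undup (flatten [seq Jbar1 i | i <- iota 1 n])).

(* The [l]-th word of {0,1}^N in lexicographic order (false < true). *)
Definition lexword (N l : nat) : seq bool :=
  nth (nseq_tuple N false) (sort <=%O (enum {: N.-tuplelexi bool})) l.

End arrangement.

Section statement_definitions.
Context {R : realType}.
Let P : probability (unitI R) R := unit_prob.
Implicit Types (x y : unitI R) (M n l : nat).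

Definition quantile (X : {RV P >-> R}) (x : unitI R) : R :=
  inf [set t : R | ((pt x)%:E < cdf X t)%E].

Definition trim M n (Y : unitI R -> R) : Prop :=
  forall y z, (forall k, (1 <= k <= n * M.+1)%N -> digit y k = digit z k) ->
  Y y = Y z.

(* For l = 0 the left end point 0 is excluded because points are in (0,1). *)
Definition Dset M n l : set (unitI R) :=
  [set x | l%:R / 2 ^+ (n * M.+1) <= pt x < l.+1%:R / 2 ^+ (n * M.+1)].

(* The coordinate of a word at j is the letter at the rank of j in [Jbar]. *)
Definition Eset M n l : set (unitI R) :=
  [set x | forall j, j \in Jbar M n ->
     digit x j = nth false (lexword (n * M.+1) l) (index j (Jbar M n))].

Definition sumRV (X : nat -> {RV P >-> R}) n : {RV P >-> R} :=
  \sum_(1 <= i < n.+1) (X i : {mfun unitI R >-> R}).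

Definition admissible M n (X : nat -> {RV P >-> R})
    (pi : 'S_(2 ^ (n * M.+1))) : Prop :=
  forall (l : 'I_(2 ^ (n * M.+1))) x y,
  Dset M n l x -> Eset M n (pi l) y -> quantile (sumRV X n) x = sumRV X n y.

Definition mutually_independent n (Q : 'I_n -> {RV P >-> R}) : Prop :=
  forall (I : {set 'I_n}) (B : 'I_n -> set R),
  (forall i, measurable (B i)) ->
  P [set x | forall i, i \in I -> B i (Q i x)] =
  (\prod_(i in I) P (Q i @^-1` B i))%E.

Definition identically_distributed n (Q : 'I_n -> {RV P >-> R}) : Prop :=
  forall (i j : 'I_n) (B : set R), measurable B ->
  distribution P (Q i) B = distribution P (Q j) B.

(* [Q i] stands for R*_{n,i+1}. *)
Record representation M n (o : 'I_(2 ^ M.+1) -> R) (Y : unitI R -> R)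
    (Q : 'I_n -> {RV P >-> R}) : Prop := Representation {
  rep_sum : forall x, Y x = \sum_(i < n) Q i x ;
  rep_indep : mutually_independent Q ;
  rep_ident : identically_distributed Q ;
  rep_trim : forall i, trim M n (Q i) ;
  rep_mean : forall i, ('E_P[Q i] = 0)%E ;
  rep_variance : forall i, ('V_P[Q i] = 1)%E ;
  rep_values : forall i, range (Q i) = range o ;
  rep_equiprobable :
    forall i s, P (Q i @^-1` [set o s]) = ((2 ^ M.+1)%:R^-1)%:E }.

End statement_definitions.

Arguments admissible {R} M n X pi.
Arguments representation {R} M n o Y Q.

(* Main.v *)
From HB Require Import structures.
Require Import Defs.
From mathcomp Require Import all_boot all_order all_algebra perm.
From mathcomp Require Import all_classical all_reals all_analysis measurable_realfun.
From mathcomp Require Import zify lra ring.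
Import Order.TTheory GRing.Theory Num.Theory.
Import numFieldNormedType.Exports.
Local Open Scope classical_set_scope.
Local Open Scope ring_scope.

(** Write [N = n (M+1)], [m = 2^(M+1)]. A family of [n] random variables that
depend only on the first [N] digits and take their values among the outcomes
[o_s] is the same thing as a map [v] from the [2^N] dyadic cells [D_l] to the
[m^n = 2^N] vectors of indices in [{1, .., m}^n], namely
[Q_i = o_(v(l)_i)] on [D_l]. Everything rests on one equivalence: such a family
is independent with uniform marginals iff [v] is a bijection.

If [v] is a bijection, it carries the uniform law of the cell index to the
uniform law on vectors, which is the product of the uniform laws on the
coordinates; independence, moments and equiprobability are then counts of
vectors ([prob_coordinates], [coordinates_representation]). Conversely,
independence gives each of the [m^n] vectors the probability [m^-n > 0], so
each one is taken on some cell: [v] is onto, hence bijective since the two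
sets have equal size ([representation_coordinates]).

The original summands have a vector [r(l)] of outcome indices on [E_l]. The
columns of the triangular arrangement are disjoint, so the [n] blocks of [M+1]
letters read from a word on [Jbar n] determine the word
([column_word_inj]), and [r] is a bijection too. A permutation [pi] therefore
corresponds to the bijection [v = r o pi], and every bijection [v] comes from
exactly one [pi = r^-1 o v]. Under this correspondence, admissibility of [pi]
says precisely that the family of [v] sums to the quantile of [S_n], because
[S_n] on [E_(pi l)] is [sum_i o_(r(pi l)_i)] and no [E_l] is empty
([Eset_nonempty]). *)

(** * Binary digits and dyadic cells *)

Fixpoint binary_value (e : nat -> bool) (N : nat) : nat :=
  if N is N'.+1 then ((binary_value e N').*2 + e N')%N else 0%N.

Lemma binary_value_lt e N : (binary_value e N < 2 ^ N)%N.
Proof. by elim: N => //= N IH; rewrite expnS; case: (e N) => /=; lia. Qed.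

Lemma binary_value_inj e e' N :
  binary_value e N = binary_value e' N <-> forall k, (k < N)%N -> e k = e' k.
Proof.
elim: N => [|N IH] /=; first by split.
split=> [eq2|ee'].
  have [vv ee] : binary_value e N = binary_value e' N /\ e N = e' N.
    by move: eq2; case: (e N); case: (e' N) => /= ?; split=> //; lia.
  move=> k; rewrite ltnS leq_eqVlt => /orP[/eqP->//|].
  by move: k; apply/IH.
rewrite ee' //; congr (_.*2 + _)%N.
by apply/IH => k kN; apply: ee'; apply: leqW.
Qed.

Lemma dyadic_sum (R : realType) (e : nat -> bool) N :
  \sum_(0 <= k < N) (e k)%:R * 2 ^- k.+1 = (binary_value e N)%:R / 2 ^+ N :> R.
Proof.
elim: N => [|N IH]; first by rewrite big_nil mul0r.
rewrite big_nat_recr //= IH natrD -mul2n natrM exprS invfM.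
by field; rewrite expf_neq0.
Qed.

(** The partial sums of the expansion increase to [x], while the partial sums
increased by [2^-K] decrease to [x]. The left bound is attained at dyadic
points; the right one never is, because the expansion has infinitely many
zeros. *)
Lemma binary_expansion_bounds (R : realType) (x : R) e N :
  binary_expansion x e ->
  (binary_value e N)%:R / 2 ^+ N <= x < (binary_value e N).+1%:R / 2 ^+ N.
Proof.
move=> [cvx zeros].
pose v K : R := (binary_value e K)%:R / 2 ^+ K.
have vS K : v K.+1 = v K + (e K)%:R * 2 ^- K.+1.
  by rewrite /v -!dyadic_sum big_nat_recr.
have p2 K : 0 < 2 ^- K :> R by rewrite invr_gt0 exprn_gt0.
have halve K : 2 ^- K = 2 ^- K.+1 + 2 ^- K.+1 :> R.
  by rewrite exprS; field; rewrite expf_neq0.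
have cvv : v K @[K --> \oo] --> x.
  by move: cvx; under eq_fun do rewrite dyadic_sum.
have vle : {homo v : a b / (a <= b)%N >-> a <= b}.
  apply: homo_leq => // [|K]; first exact: le_trans.
  by rewrite vS lerDl mulr_ge0 // ltW.
have uge : {homo (fun K => v K + 2 ^- K) : a b / (a <= b)%N >-> b <= a}.
  apply: homo_leq => // [a b c ab bc|K]; first exact: le_trans bc ab.
  by rewrite vS (halve K); case: (e K) (p2 K.+1) => /=; rewrite ?mul1r ?mul0r; lra.
have vx : v N <= x by apply: (cvgr_to_ge cvv); exists N => // j /= /vle.
(* A zero digit beyond N keeps the tail strictly below 2^-N. *)
have [k Nk ek] := zeros N.
have xk : x <= v k.+1 + 2 ^- k.+1.
  apply: (cvgr_to_le cvv); exists k.+1 => // j /= /uge; apply: le_trans.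
  by rewrite lerDl ltW.
rewrite vx /= -natr1 mulrDl mul1r; apply: le_lt_trans xk _.
apply: lt_le_trans (uge _ _ Nk).
by rewrite vS ek (halve k); have := p2 k.+1; rewrite mul0r; lra.
Qed.

Lemma dyadic_index_unique (R : realType) (N k l : nat) (x : R) :
  k%:R / 2 ^+ N <= x < k.+1%:R / 2 ^+ N ->
  l%:R / 2 ^+ N <= x < l.+1%:R / 2 ^+ N -> k = l.
Proof.
have p2 : 0 < 2 ^- N :> R by rewrite invr_gt0 exprn_gt0.
move=> /andP[ka kb] /andP[la lb].
have := le_lt_trans ka lb; have := le_lt_trans la kb.
by rewrite !ltr_pM2r // !ltr_nat !ltnS => ? ?; apply/eqP; rewrite eqn_leq; apply/andP.
Qed.

(** The number whose binary digits are the first [N] digits of [x]: this is also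
the index of the half-open dyadic interval of length [2^-N] that contains [x],
by [cellP]. *)
Definition cell {R : realType} (N : nat) (x : unitI R) : 'I_(2 ^ N) :=
  Ordinal (binary_value_lt (fun k => digit x k.+1) N).

Lemma cellP (R : realType) N (x : unitI R) (l : 'I_(2 ^ N)) :
  cell N x = l <-> l%:R / 2 ^+ N <= pt x < l.+1%:R / 2 ^+ N.
Proof.
have xl := binary_expansion_bounds _ _ _ N (digitP x).
split=> [<- //|lx]; apply: val_inj; exact: dyadic_index_unique xl lx.
Qed.

Lemma cell_digits (R : realType) N (x y : unitI R) :
  cell N x = cell N y <->
  forall k, (1 <= k <= N)%N -> digit x k = digit y k.
Proof.
have -> : (cell N x = cell N y) <-> val (cell N x) = val (cell N y).
  by split=> [->|/val_inj].
rewrite binary_value_inj; split=> [xy [|k]//|xy k kN]; last by apply: xy.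
by move=> kN; apply: xy.
Qed.

(** The midpoint of a dyadic interval avoids the end points 0 and 1, which are
not points of the sample space. *)
Lemma cell_surj (R : realType) N (l : 'I_(2 ^ N)) :
  exists x : unitI R, cell N x = l.
Proof.
have p2 : 0 < 2 ^+ N :> R by rewrite exprn_gt0.
have mid01 : 0 < ((l%:R + 2^-1) / 2 ^+ N : R) < 1.
  have l0 : 0 <= l%:R :> R := ler0n _ _.
  rewrite divr_gt0 ?ltr_wpDl ?invr_gt0 //=.
  rewrite ltr_pdivrMr // mul1r.
  have : l.+1%:R <= 2 ^+ N :> R by rewrite -natrX ler_nat ltn_ord.
  by rewrite -natr1 => ?; lra.
exists (exist (fun u : R => is_true (0 < u < 1)) _ mid01).
apply/cellP; rewrite /pt /= ler_pM2r ?invr_gt0 // ltr_pM2r ?invr_gt0 //.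
by rewrite -(natr1 l) lerDl invr_ge0 ler0n ltrD2l invf_lt1 ?ltr1n /=.
Qed.

(** Every word of length [N] is the binary writing of a cell index, so a point of
that cell has the required digits. *)
Lemma prescribed_digits (R : realType) N (e : nat -> bool) :
  exists x : unitI R, forall k, (k < N)%N -> digit x k.+1 = e k.
Proof.
have [x /(congr1 val) /binary_value_inj xe] :=
  cell_surj R N (Ordinal (binary_value_lt e N)).
by exists x.
Qed.

(** * The cell index is uniformly distributed *)

Lemma measurable_pt_preimage (R : realType) (B : set R) :
  measurable B -> measurable ((@pt R) @^-1` B).
Proof. by move=> mB; exists B => //; rewrite setTI. Qed.

Lemma cell_fiberE (R : realType) N (l : 'I_(2 ^ N)) :
  [set x : unitI R | cell N x = l] =
  (@pt R) @^-1` `[l%:R / 2 ^+ N, l.+1%:R / 2 ^+ N[.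
Proof. by apply/seteqP; split=> x; rewrite /preimage /= in_itv /=; move/cellP. Qed.

Lemma measurable_cell_fiber (R : realType) N (l : 'I_(2 ^ N)) :
  measurable [set x : unitI R | cell N x = l].
Proof. rewrite cell_fiberE; apply: measurable_pt_preimage; exact: measurable_itv. Qed.

Lemma prob_cell_fiber (R : realType) N (l : 'I_(2 ^ N)) :
  unit_prob [set x : unitI R | cell N x = l] = (2 ^- N)%:E.
Proof.
have p2 : 0 < 2 ^- N :> R by rewrite invr_gt0 exprn_gt0.
pose b (k : nat) : R := k%:R / 2 ^+ N.
have bS : b l.+1 - b l = 2 ^- N by rewrite /b -natr1; ring.
have bl1 : b l.+1 <= 1.
  by rewrite ler_pdivrMr ?exprn_gt0 // mul1r -natrX ler_nat ltn_ord.
have b0 : 0 <= b l by rewrite divr_ge0 ?exprn_ge0.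
(* The point 0 is missing from the first interval, hence its open left end. *)
rewrite /unit_prob.
have -> : pt @` [set x | cell N x = l] =
    [set` Interval (BSide (l != 0 :> nat) (b l)) (BLeft (b l.+1))].
  apply/seteqP; split=> [_ [x /cellP/andP[lx xl] <-]|r] /=.
    rewrite in_itv /= xl andbT; case: eqP => [l0|_] /=; last exact: lx.
    by rewrite /b l0 mul0r; case/andP: (svalP x).
  rewrite in_itv /= => /andP[lr rl].
  have r0 : 0 < r.
    case: eqP lr => [_|/eqP l0] /=; first exact: le_lt_trans.
    by apply: lt_le_trans; rewrite divr_gt0 ?exprn_gt0 // ltr0n lt0n.
  have r01 : 0 < r < 1 by rewrite r0 (lt_le_trans rl).
  exists (exist (fun u : R => is_true (0 < u < 1)) _ r01) => //.
  apply/cellP; rewrite /pt /= rl andbT.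
  by case: eqP lr => [_ /ltW|].
rewrite lebesgue_measure_itv /= lte_fin ifT; last by rewrite -subr_gt0 bS.
by rewrite -EFinB bS.
Qed.

Lemma cell_eventE (R : realType) N (A : pred 'I_(2 ^ N)) :
  [set x : unitI R | A (cell N x)] =
  \bigcup_(l in [set` A]) [set x | cell N x = l].
Proof.
by apply/seteqP; split=> [x Ax|x [l Al /= ->//]]; exists (cell N x).
Qed.

Lemma measurable_cell_event (R : realType) N (A : pred 'I_(2 ^ N)) :
  measurable [set x : unitI R | A (cell N x)].
Proof.
rewrite cell_eventE; apply: fin_bigcup_measurable => // l _.
exact: measurable_cell_fiber.
Qed.

Lemma prob_cell_event (R : realType) N (A : pred 'I_(2 ^ N)) :
  unit_prob [set x : unitI R | A (cell N x)] = (#|A|%:R / 2 ^+ N)%:E.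
Proof.
rewrite cell_eventE measure_fin_bigcup //; last 2 first.
  by move=> k l _ _ [x [/= <- <-]].
  by move=> l _; exact: measurable_cell_fiber.
rewrite (eq_fsbigr (fun=> (2 ^- N)%:E)); last by move=> l _; exact: prob_cell_fiber.
rewrite -(bigfs _ (enum_uniq 'I_(2 ^ N))) => [|i _]; last by rewrite mem_enum.
rewrite big_enum_cond /= sumEFin big_const iter_addr addr0.
by rewrite mulr_natl.
Qed.

(** * Disjointness of the columns and coding of words *)

(** Every entry of a row precedes every entry of a later row, since the entries of
a row stop at the total length of the rows up to it. *)
Lemma row_entry_inj M rho rho' i i' : (0 < rho)%N -> (0 < rho')%N ->
  (0 < i <= row_length M rho)%N -> (0 < i' <= row_length M rho')%N ->
  row_entry M rho i = row_entry M rho' i' -> rho = rho' /\ i = i'.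
Proof.
have later a b j k : (0 < a < b)%N -> (j <= row_length M a)%N -> (0 < k)%N ->
    (row_entry M a j < row_entry M b k)%N.
  move=> /andP[a0 ab] ja k0; rewrite /row_entry.
  rewrite (@big_cat_nat _ _ _ a.+1 1 b) //= big_nat_recr //=.
  by lia.
move=> r0 r'0 /andP[i0 ir] /andP[i'0 ir'] eqe.
case: (ltngtP rho rho') => [rr|rr|rr].
- by have := later _ _ i i' (introT andP (conj r0 rr)) ir i'0; rewrite eqe ltnn.
- by have := later _ _ i' i (introT andP (conj r'0 rr)) ir' i0; rewrite eqe ltnn.
- by split=> //; move: eqe; rewrite rr /row_entry => /addnI.
Qed.

(** The [k]-th entry of column [i] lies in row [(i-1)(M+1) + k], which is long
enough to have an [i]-th entry. *)
Lemma col_index_inj M i i' k k' :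
  (0 < i)%N -> (0 < i')%N -> (0 < k)%N -> (0 < k')%N ->
  col_index M i k = col_index M i' k' -> i = i' /\ k = k'.
Proof.
move=> i0 i'0 k0 k'0; rewrite !col_indexE // => eqe.
have inrow j l : (0 < j)%N -> (0 < l)%N ->
    (0 < j <= row_length M (j.-1 * M.+1 + l))%N.
  move=> j0 l0; rewrite j0 /row_length -subn1 -addnBA // divnMDl //.
  by case: j j0 => // j _ /=; rewrite ltnS leq_addr.
have rows j l : (0 < l)%N -> (0 < j.-1 * M.+1 + l)%N.
  by move=> l0; rewrite addn_gt0 l0 orbT.
have [rr ii] := row_entry_inj _ _ _ _ _ (rows i k k0) (rows i' k' k'0)
  (inrow i k i0 k0) (inrow i' k' i'0 k'0) eqe.
by split=> //; move: rr; rewrite ii => /addnI.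
Qed.

Lemma mem_Jbar M n j : reflect
  (exists i k, [/\ (1 <= i <= n)%N, (1 <= k <= M.+1)%N & j = col_index M i k])
  (j \in Jbar M n).
Proof.
rewrite /Jbar mem_sort mem_undup; apply: (iffP flatten_mapP) => /=.
  move=> [i]; rewrite mem_iota add1n ltnS => i1 /mapP[k].
  by rewrite mem_iota add1n ltnS => k1 ->; exists i, k.
move=> [i [k [i1 k1 ->]]]; exists i; first by rewrite mem_iota add1n ltnS.
by apply/mapP; exists k; rewrite // mem_iota add1n ltnS.
Qed.

Lemma size_Jbar M n : size (Jbar M n) = (n * M.+1)%N.
Proof.
rewrite /Jbar size_sort undup_id.
  rewrite size_flatten /shape -map_comp sumnE big_map.
  rewrite (eq_bigr (fun=> M.+1)) => [|i _]; last by rewrite /= size_map size_iota.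
  by rewrite big_const_seq count_predT size_iota iter_addn_0 mulnC.
apply: (allpairs_uniq (f := col_index M)); rewrite ?iota_uniq //.
move=> [i k] [i' k'] /allpairsP[[a b] [+ + [-> ->]]].
rewrite !mem_iota => /andP[i0 _] /andP[k0 _] /allpairsP[[c d] [+ + [-> ->]]].
rewrite !mem_iota => /andP[i'0 _] /andP[k'0 _] /= eqc.
by have [/= -> ->] := col_index_inj _ _ _ _ _ i0 i'0 k0 k'0 eqc.
Qed.

Definition word (N l : nat) (j : nat) : bool := nth false (lexword N l) j.

(** The enumeration lists every word exactly once. *)
Lemma lexword_inj N (l l' : 'I_(2 ^ N)) :
  (forall j, (j < N)%N -> word N l j = word N l' j) -> l = l'.
Proof.
rewrite /word /lexword; set s := sort _ _ => ll'.
have szs : size s = (2 ^ N)%N.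
  by rewrite size_sort -cardE card_tuple card_bool.
have us : uniq s by rewrite sort_uniq enum_uniq.
set z := nseq_tuple N false in ll'.
suff nn : nth z s l = nth z s l'.
  by apply: val_inj; apply/eqP; rewrite -(nth_uniq z _ _ us) ?szs ?ltn_ord // nn.
apply: val_inj; apply: (@eq_from_nth _ false); first by rewrite !size_tuple.
by move=> j; rewrite size_tuple; apply: ll'.
Qed.

(** The letters that decide the value of the summand [R_(i+1)] on [E_l]; [i]
starts at 0 here, whereas columns and their entries are counted from 1. *)
Definition column_word (M n : nat) (l : nat) (i : 'I_n) : M.+1.-tuple bool :=
  [tuple word (n * M.+1) l (index (col_index M i.+1 k.+1) (Jbar M n)) | k < M.+1].

Lemma col_index_in_Jbar M n (i : 'I_n) (k : 'I_M.+1) :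
  col_index M i.+1 k.+1 \in Jbar M n.
Proof. by apply/mem_Jbar; exists i.+1, k.+1; rewrite !ltn_ord. Qed.

(** Every element of [Jbar n] belongs to one of the [n] columns, so the blocks
cover all letters of the word. *)
Lemma column_word_inj M n (l l' : 'I_(2 ^ (n * M.+1))) :
  (forall i, column_word M n l i = column_word M n l' i) -> l = l'.
Proof.
move=> ll'; apply: lexword_inj => p pN.
have uJ : uniq (Jbar M n) by rewrite sort_uniq undup_uniq.
have pJ : (p < size (Jbar M n))%N by rewrite size_Jbar.
have /mem_Jbar [[|i] [[|k] [// /andP[_ iN] // /andP[_ kM] eqj]]] := mem_nth 0%N pJ.
have := congr1 (fun t => tnth t (Ordinal kM)) (ll' (Ordinal iN)).
by rewrite !tnth_mktuple /= -eqj index_uniq.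
Qed.

Lemma Eset_column_word (R : realType) M n l (y : unitI R) (i : 'I_n) (k : 'I_M.+1) :
  Eset M n l y -> digit y (col_index M i.+1 k.+1) = tnth (column_word M n l i) k.
Proof. by move=> yE; rewrite tnth_mktuple; apply/yE/col_index_in_Jbar. Qed.

(** [E_l] constrains finitely many digits, all of positive rank, so a long enough
prefix can be prescribed to satisfy them. *)
Lemma Eset_nonempty (R : realType) M n l : exists y : unitI R, Eset M n l y.
Proof.
have [y yP] := prescribed_digits R (\max_(j <- Jbar M n) j)
  (fun k => word (n * M.+1) l (index k.+1 (Jbar M n))).
exists y => j jJ.
have /prednK j1 : (0 < j)%N.
  have /mem_Jbar[[|i] [[|k] [// _ // _ ->]]] := jJ.
  by rewrite col_indexE // /row_entry addnS.
by rewrite -{1}j1 yP j1 //; exact: leq_bigmax_seq.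
Qed.

(** * Random variables that factor through the cell index *)

Lemma expectation_finite (d : measure_display) (T : measurableType d)
    (R : realType) (P : probability T R) (I : finType) (c : T -> I) (g : I -> R) :
  (forall s, measurable [set x | c x = s]) ->
  ('E_P[g \o c] = \sum_s (g s)%:E * P [set x | c x = s])%E.
Proof.
move=> mc; rewrite unlock.
have -> : (\int[P]_w ((g \o c) w)%:E =
    \int[P]_w (\sum_(s <- enum I) (g s * \1_[set x | c x = s] w)%:E))%E.
  apply: eq_integral => x _; rewrite sumEFin big_enum /= (bigD1 (c x)) //=.
  rewrite indicE mem_set // mulr1 big1 ?addr0 // => s /eqP sc.
  by rewrite indicE memNset ?mulr0 // => /esym.
have int1 s : P.-integrable setT (fun x => (\1_[set x | c x = s] x)%:E).
  exact: integrable_indic.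
rewrite integral_sum //=; last first.
  by move=> s; under eq_fun do rewrite EFinM; exact: integrableZl.
rewrite big_enum /=; apply: eq_bigr => s _.
under eq_integral do rewrite EFinM.
by rewrite integralZl // integral_indic // setIT.
Qed.

Definition cell_fun {R : realType} {N : nat} (g : 'I_(2 ^ N) -> R)
  (x : unitI R) : R := g (cell N x).

Lemma measurable_cell_fun (R : realType) N (g : 'I_(2 ^ N) -> R) :
  measurable_fun setT (cell_fun g).
Proof.
move=> _ B _; rewrite setTI.
have -> : cell_fun g @^-1` B = [set x | `[< B (g (cell N x)) >] ].
  by apply/seteqP; split=> x /asboolP.
exact: (measurable_cell_event _ _ (fun l => `[< B (g l) >])).
Qed.

HB.instance Definition _ (R : realType) N (g : 'I_(2 ^ N) -> R) :=
  isMeasurableFun.Build _ _ _ _ (cell_fun g) (measurable_cell_fun R N g).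

(** A bijection turns the uniform law on cells into the uniform law on vectors,
under which a product event has as many vectors as the product of the sizes of
its factors. *)
Lemma prob_coordinates (R : realType) N n m
    (v : 'I_(2 ^ N) -> {ffun 'I_n -> 'I_m}) (F : 'I_n -> pred 'I_m) :
  bijective v ->
  unit_prob [set x : unitI R | forall i, F i (v (cell N x) i)] =
  (\prod_i (#|F i|%:R / m%:R))%:E.
Proof.
move=> bv.
have -> : [set x : unitI R | forall i, F i (v (cell N x) i)] =
    [set x | v (cell N x) \in family F].
  by apply/seteqP; split=> x; [move=> h; apply/familyP|move=> /familyP].
rewrite (prob_cell_event _ _ (fun l => v l \in family F)); congr _%:E.
(* Bijectivity of v forces 2^N = m^n. *)
have mN : 2 ^+ N = m%:R ^+ n :> R.
  by rewrite -!natrX -[(2 ^ N)%N]card_ord (bij_eq_card bv) card_ffun !card_ord.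
rewrite mN prodf_div prodr_const card_ord; congr (_ / _).
rewrite (_ : #|_| = \prod_i #|F i|)%N ?natr_prod //.
have := card_family F; rewrite foldrE big_image => <-.
have [w _ wv] := bv.
rewrite -(_ : #|[predI codom v & family F]| = #|family F|).
  by rewrite -card_preim //; exact: bij_inj.
by apply: eq_card => f; rewrite !inE -{1}[f]wv codom_f.
Qed.

Lemma bijective_of_surj (A B : finType) (v : A -> B) :
  #|A| = #|B| -> (forall f, exists l, v l = f) -> bijective v.
Proof.
move=> cAB /choice[w wv].
have winj : injective w by exact: can_inj wv.
have bw : bijective w by apply: inj_card_bij => //; rewrite cAB.
exact: (bij_can_bij bw (wv : cancel w v)).
Qed.

Lemma prob_coordinate (R : realType) N n m
    (v : 'I_(2 ^ N) -> {ffun 'I_n -> 'I_m}) (i : 'I_n) (F : pred 'I_m) :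
  (0 < m)%N -> bijective v ->
  unit_prob [set x : unitI R | F (v (cell N x) i)] = (#|F|%:R / m%:R)%:E.
Proof.
move=> m0 bv.
have := prob_coordinates R _ _ _ _ (fun j => if j == i then F else predT) bv.
rewrite (bigD1 i) //= eqxx big1 ?mulr1 => [<-|j /negPf->]; last first.
  by rewrite cardT size_enum_ord divff // pnatr_eq0 -lt0n.
congr unit_prob; apply/seteqP; split=> x /=; last by move=> /(_ i); rewrite eqxx.
by move=> Fx j; case: eqP => // ->.
Qed.

Lemma expectation_coordinate (R : realType) N n m
    (v : 'I_(2 ^ N) -> {ffun 'I_n -> 'I_m}) (i : 'I_n) (g : 'I_m -> R) :
  (0 < m)%N -> bijective v ->
  ('E_unit_prob[fun x : unitI R => g (v (cell N x) i)] =
   (m%:R^-1 * \sum_s g s)%:E)%E.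
Proof.
move=> m0 bv.
have := expectation_finite _ _ R unit_prob _ (fun x => v (cell N x) i) g.
move=> -> => [|s]; last first.
  have -> : [set x : unitI R | v (cell N x) i = s] =
      [set x | v (cell N x) i == s] by apply/seteqP; split=> x /eqP.
  exact: (measurable_cell_event _ _ (fun l => v l i == s)).
rewrite mulr_sumr -sumEFin; apply: eq_bigr => s _.
rewrite EFinM muleC; congr (_ * _)%E.
have := prob_coordinate R _ _ _ v i (pred1 s) m0 bv.
rewrite card1 mul1r => <-.
by congr unit_prob; apply/seteqP; split=> x /= /eqP.
Qed.

(** * Independent families as bijections onto outcome vectors *)

(** The index vector [v (cell x)] is uniformly distributed, hence so are its
coordinates, and they are independent; the sums of [o] and of its square then
give the mean and the variance. *)
Lemma coordinates_representation (R : realType) M n (o : 'I_(2 ^ M.+1) -> R)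
    (v : 'I_(2 ^ (n * M.+1)) -> {ffun 'I_n -> 'I_(2 ^ M.+1)})
    (Y : unitI R -> R) (Q : 'I_n -> {RV (@unit_prob R) >-> R}) :
  injective o -> \sum_s o s = 0 -> \sum_s o s ^+ 2 = (2 ^ M.+1)%:R ->
  bijective v -> (forall i x, Q i x = o (v (cell (n * M.+1) x) i)) ->
  (forall x, Y x = \sum_(i < n) Q i x) -> representation M n o Y Q.
Proof.
move=> oinj osum osq bv QE YQ.
have m0 : (0 < 2 ^ M.+1)%N by rewrite expn_gt0.
have mR : (2 ^ M.+1)%:R != 0 :> R by rewrite pnatr_eq0 -lt0n.
have PQ i (B : set R) : unit_prob (Q i @^-1` B) =
    (#|[pred s | `[< B (o s) >]]|%:R / (2 ^ M.+1)%:R)%:E.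
  rewrite -(prob_coordinate R _ _ _ v i _ m0 bv); congr unit_prob.
  by apply/seteqP; split=> x; rewrite /preimage /= QE;
    [move=> ?; apply/asboolP|move/asboolP].
have QEfun i : (Q i : unitI R -> R) = fun x => o (v (cell (n * M.+1) x) i).
  by apply/funext => x.
have mean i : ('E_unit_prob[Q i] = 0)%E.
  have := expectation_coordinate R _ _ _ v i o m0 bv.
  by rewrite QEfun => ->; rewrite osum mulr0.
split=> //.
- move=> I B mB.
  rewrite (eq_bigr (fun i =>
    (#|[pred s | `[< B i (o s) >]]|%:R / (2 ^ M.+1)%:R)%:E)) => [|i _]; last exact: PQ.
  rewrite prodEFin big_mkcond /=.
  (* Coordinates outside I are left free, which contributes factors 1. *)
  have := prob_coordinates R _ _ _ v
    (fun i => if i \in I then [pred s | `[< B i (o s) >]] else predT) bv.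
  rewrite (eq_bigr (fun i => if i \in I then
    #|[pred s | `[< B i (o s) >]]|%:R / (2 ^ M.+1)%:R else 1)) => [<-|i _]; last first.
    by case: ifP => // _; rewrite cardT size_enum_ord divff.
  congr unit_prob; apply/seteqP; split=> x /= h i.
    by case: ifP => //= iI; apply/asboolP; rewrite -QE; exact: h.
  by move=> iI; have := h i; rewrite iI /= QE => /asboolP.
- by move=> i j B mB; exact: etrans (PQ i B) (esym (PQ j B)).
- by move=> i y z /cell_digits yz; rewrite !QE yz.
(* The mean vanishes, so the variance is the mean of the square. *)
- move=> i; rewrite /variance covariance.unlock mean /=.
  have -> : ((Q i \- cst 0) * (Q i \- cst 0))%R =
      fun x => o (v (cell (n * M.+1) x) i) ^+ 2.
    by apply/funext => x; rewrite mulrfctE /= subr0 -QE expr2.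
  have := expectation_coordinate R _ _ _ v i (fun s => o s ^+ 2) m0 bv.
  by move=> ->; rewrite osq mulVf.
- move=> i; apply/seteqP; split=> [_ [x _ <-]|_ [s _ <-]].
    by rewrite QE; exists (v (cell (n * M.+1) x) i).
  have [w _ wv] := bv; have [x xl] := cell_surj R _ (w [ffun=> s]).
  by exists x; rewrite // QE xl wv ffunE.
- move=> i s.
  have cs : #|[pred t | `[< [set o s] (o t) >]]| = 1%N.
    apply: (eq_card_trans (card1 s)) => t.
    by rewrite !inE /=; apply/asboolP/eqP => [/oinj|->].
  by have := PQ i [set o s]; rewrite cs mul1r.
Qed.

(** Trimness makes each [Q_i] constant on every cell, so its value there can be
read at a chosen point of the cell. Independence and equiprobability give every
vector of outcomes a positive probability, hence a cell where it is taken; so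
[v] is onto, and by cardinality bijective. *)
Lemma representation_coordinates (R : realType) M n (o : 'I_(2 ^ M.+1) -> R)
    (Y : unitI R -> R) (Q : 'I_n -> {RV (@unit_prob R) >-> R}) :
  injective o -> representation M n o Y Q ->
  exists2 v : 'I_(2 ^ (n * M.+1)) -> {ffun 'I_n -> 'I_(2 ^ M.+1)},
    bijective v & forall i x, Q i x = o (v (cell (n * M.+1) x) i).
Proof.
move=> oinj [_ ind _ tr _ _ vals equi].
have /choice[pick_x xP] := cell_surj R (n * M.+1).
have /choice[s sP] : forall ix : 'I_n * unitI R, exists s, Q ix.1 ix.2 = o s.
  move=> [i x]; have : range (Q i) (Q i x) by exists x.
  by rewrite vals => -[s _ <-]; exists s.
pose v l := [ffun i => s (i, pick_x l)].
have QE i x : Q i x = o (v (cell (n * M.+1) x) i).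
  by rewrite ffunE -sP; apply: tr; apply/cell_digits; rewrite xP.
exists v => //; apply: bijective_of_surj.
  by rewrite card_ffun !card_ord -expnM mulnC.
move=> f.
have := ind [set: 'I_n]%SET (fun i => [set o (f i)]) (fun i => measurable_set1 _).
rewrite (eq_bigr (fun=> ((2 ^ M.+1)%:R^-1)%:E)) => [|i _]; last exact: equi.
rewrite prodEFin.
case: (pselect (exists x, forall i, Q i x = o (f i))) => [[x xf] _|nx].
  exists (cell (n * M.+1) x); apply/ffunP => i.
  by apply: oinj; rewrite -QE.
rewrite (_ : [set x | _] = set0); last first.
  by apply/seteqP; split=> // x /= xf; apply: nx; exists x => i; apply: xf; rewrite inE.
rewrite measure0 => /eqP; rewrite eqe eq_sym => /eqP /(congr1 (fun r => 0 < r)).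
by rewrite ltxx prodr_gt0.
Qed.

(** * The canonical bijection *)

Theorem theorem1 (R : realType) (M : nat)
    (* the random variable O, its outcomes and the words coding them *)
    (O : {RV (@unit_prob R) >-> R}) (o : 'I_(2 ^ M.+1) -> R)
    (varsigma : 'I_(2 ^ M.+1) -> M.+1.-tuple bool)
    (O_digits : forall x y : unitI R,
       O x = O y <-> (forall k, (1 <= k <= M.+1)%N -> digit x k = digit y k))
    (o_increasing : forall s t : 'I_(2 ^ M.+1), (s < t)%N -> o s < o t)
    (o_outcomes : range O = range o)
    (o_equiprobable : forall s,
       unit_prob (O @^-1` [set o s]) = ((2 ^ M.+1)%:R^-1)%:E)
    (o_sum : \sum_s o s = 0)
    (O_variance : ('V_unit_prob[ O ] = 1)%E)
    (o_sum_sq : \sum_s o s ^+ 2 = (2 ^ M.+1)%:R)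
    (varsigmaP : forall (x : unitI R) s, O x = o s <->
       (forall k : 'I_M.+1, digit x k.+1 = tnth (varsigma s) k))
    (* the copies R_i (i >= 1) of O, read off the columns *)
    (Rv : nat -> {RV (@unit_prob R) >-> R})
    (RvP : forall i, (1 <= i)%N -> forall (x : unitI R) s, Rv i x = o s <->
       (forall k : 'I_M.+1, digit x (col_index M i k.+1) = tnth (varsigma s) k))
    (n : nat) (n_gt0 : (0 < n)%N) :
  exists Phi : 'S_(2 ^ (n * M.+1)) -> ('I_n -> {RV (@unit_prob R) >-> R}),
    (forall pi, admissible M n Rv pi ->
       forall (l : 'I_(2 ^ (n * M.+1))) (x y : unitI R) (i : 'I_n),
       Dset M n l x -> Eset M n (pi l) y -> Phi pi i x = Rv i.+1 y) /\
    set_bij [set pi | admissible M n Rv pi]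
            [set Q | representation M n o (quantile (sumRV Rv n)) Q]
            Phi.
Proof.
have oinj : injective o.
  move=> s t; case: (ltngtP s t) => [/o_increasing|/o_increasing|/val_inj//].
    by move=> /lt_eqF/eqP st ts; case: st.
  by move=> /lt_eqF/eqP ts st; case: ts.
pose N := (n * M.+1)%N.
have vs_inj : injective varsigma.
  move=> s t st; have [x _ xs] : range O (o s) by rewrite o_outcomes; exists s.
  by apply: oinj; rewrite -xs; apply/varsigmaP; rewrite -st; apply/varsigmaP.
have [outcome outcomeK varsigmaK] : bijective varsigma.
  by apply: inj_card_bij => //; rewrite card_ord card_tuple card_bool.
pose r (l : 'I_(2 ^ N)) := [ffun i : 'I_n => outcome (column_word M n l i)].
have RvE (l : 'I_(2 ^ N)) (y : unitI R) (i : 'I_n) :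
    Eset M n l y -> Rv i.+1 y = o (r l i).
  move=> yl; apply/RvP => // k.
  by rewrite ffunE varsigmaK; exact: Eset_column_word.
have rinj : injective r.
  move=> l l' /ffunP rl; apply: column_word_inj => i.
  by have := rl i; rewrite !ffunE => /(can_inj varsigmaK).
have rbij : bijective r.
  apply: inj_card_bij => //.
  by rewrite card_ffun !card_ord -expnM mulnC.
have sumE y : sumRV Rv n y = \sum_(i < n) Rv i.+1 y.
  by rewrite /sumRV mfun_sum big_add1 big_mkord.
pose Phi (pi : 'S_(2 ^ N)) (i : 'I_n) : {RV (@unit_prob R) >-> R} :=
  cell_fun (fun l => o (r (pi l) i)).
have PhiE pi i x : Phi pi i x = o (r (pi (cell N x)) i) by [].
exists Phi; split.
  by move=> pi _ l x y i /cellP xl yl; rewrite PhiE xl (RvE _ _ _ yl).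
split.
- move=> pi pi_adm;
  apply: (coordinates_representation _ _ _ _ (fun l => r (pi l))) => //.
    by apply: bij_comp => //; exact: Bijective (permK pi) (permKV pi).
  move=> x; have [y yl] := Eset_nonempty R M n (pi (cell N x)).
  rewrite (pi_adm (cell N x) x y) ?sumE //; last exact/cellP.
  by apply: eq_bigr => i _; rewrite PhiE (RvE _ _ _ yl).
- move=> pi pi' _ _ eqPhi; apply/permP => l.
  have [x xl] := cell_surj R N l.
  apply: rinj; apply/ffunP => i; apply: oinj.
  by rewrite -xl -!PhiE eqPhi.
- move=> Q repQ; have [v vbij QE] := representation_coordinates _ _ _ _ _ _ oinj repQ.
  (* The only permutation with r o pi = v is r^-1 o v. *)
  have [r' rK r'K] := rbij.
  have pi_inj : injective (r' \o v).
    by apply: inj_comp; [exact: can_inj r'K|exact: bij_inj].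
  have piE l : r (perm pi_inj l) = v l by rewrite permE /= r'K.
  exists (perm pi_inj).
    move=> l x y /cellP xl yl; rewrite sumE (rep_sum repQ).
    by apply: eq_bigr => i _; rewrite QE xl (RvE _ _ _ yl) piE.
  apply/funext => i; apply/mfuneqP => x.
  by rewrite PhiE piE QE.
Qed.
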